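(* Let $\mathfrak{A}$ be a unital $C^*$-algebra, $a\in\mathfrak{A}$ a nonzero positive element, and let $x\in\mathfrak{A}_a$. Then $$v_a^2(x)\le\frac12 v_a(x^2)+\frac14\left\|xx^{\sharp_a}+x^{\sharp_a}x\right\|_a.$$
   Context: $\mathcal{S}(\mathfrak{A})$ is the set of states of $\mathfrak{A}$ and $\mathcal{S}_a(\mathfrak{A})=\{f/f(a): f\in\mathcal{S}(\mathfrak{A}),\ f(a)\ne 0\}$. For $x\in\mathfrak{A}$, $\|x\|_a=\sup\{\sqrt{f(x^*ax)}: f\in\mathcal{S}_a(\mathfrak{A})\}\in[0,\infty]$, and the $a$-numerical radius is $v_a(x)=\sup\{|f(ax)|: f\in\mathcal{S}_a(\mathfrak{A})\}$; $v_a^2(x)$ means $(v_a(x))^2$. An element $x^{\sharp_a}\in\mathfrak{A}$ is an $a$-adjoint of $x$ if $ax^{\sharp_a}=x^*a$; $\mathfrak{A}_a$ is the set of all elements of $\mathfrak{A}$ admitting an $a$-adjoint (a subalgebra of $\mathfrak{A}$ on which $\|\cdot\|_a$ is a finite semi-norm). $a$-adjoints need not be unique; $x^{\sharp_a}$ denotes an $a$-adjoint of $x$, and the quantities in the claim do not depend on the choice. *)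

(* Defs.v *)
From HB Require Import structures.
From mathcomp Require Import all_boot all_order all_algebra.
From mathcomp Require Import all_classical all_reals all_analysis.
From mathcomp Require Import complex.

Set Implicit Arguments.
Unset Strict Implicit.
Unset Printing Implicit Defensive.

Import Order.TTheory GRing.Theory Num.Theory.
Import ComplexField.Normc.

Local Open Scope classical_set_scope.
Local Open Scope complex_scope.
Local Open Scope ring_scope.

(* The norm is a field of the structure because Hierarchy-Builder rejects the
   join of a ring with a normedZmodType declared above numDomainType, so that
   completeNormedModType cannot be combined with algType. *)
HB.mixin Record Algebra_isCStar (R : realType) A & GRing.Algebra R[i] A := {
  cstar_norm : A -> R;
  cstar_norm_eq0 : forall x : A, cstar_norm x = 0 -> x = 0;
  cstar_normD : forall x y : A,
    cstar_norm (x + y) <= cstar_norm x + cstar_norm y;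
  cstar_normZ : forall (c : R[i]) (x : A),
    cstar_norm (c *: x) = normc c * cstar_norm x;
  cstar_normM : forall x y : A,
    cstar_norm (x * y) <= cstar_norm x * cstar_norm y;
  cstar_complete : forall u : nat -> A,
    (forall e : R, 0 < e -> exists N : nat, forall m n : nat,
       (N <= m)%N -> (N <= n)%N -> cstar_norm (u m - u n) < e) ->
    exists l : A, forall e : R, 0 < e -> exists N : nat, forall n : nat,
       (N <= n)%N -> cstar_norm (u n - l) < e;
  star : A -> A;
  starK : forall x : A, star (star x) = x;
  starD : forall x y : A, star (x + y) = star x + star y;
  starZ : forall (c : R[i]) (x : A), star (c *: x) = c^*%C *: star x;
  starM : forall x y : A, star (x * y) = star y * star x;
  cstar_identity : forall x : A, cstar_norm (star x * x) = cstar_norm x ^+ 2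
}.

#[short(type="cstarAlgType")]
HB.structure Definition CStarAlgebra (R : realType) :=
  {A of GRing.Algebra R[i] A & Algebra_isCStar R A}.

Section CStarAlgebraDefs.
Context {R : realType} {A : cstarAlgType R}.

Definition positive (p : A) : Prop := exists b : A, p = star b * b.

(* On a unital C*-algebra a positive functional f has norm f 1. *)
Definition state (f : {scalar A}) : Prop :=
  (forall p : A, positive p -> 0 <= f p) /\ f 1 = 1.

Definition states_at (a : A) : set (A -> R[i]) :=
  [set g | exists f : {scalar A},
     [/\ state f, f a != 0 & g = (fun x => f x / f a)]].

(* Least upper bound in [0, +oo] of a set of nonnegative numbers; adjoining 0
   only matters for the empty set, whose ereal_sup is -oo. *)
Definition nneg_sup (E : set \bar R) : \bar R := ereal_sup (0%E |` E).

(* For f in states_at a, f (star x * a * x) is a nonnegative real. *)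
Definition anorm (a x : A) : \bar R :=
  nneg_sup [set (Num.sqrt (complex.Re (f (star x * a * x))))%:E
           | f in states_at a].

Definition anumradius (a x : A) : \bar R :=
  nneg_sup [set (normc (f (a * x)))%:E | f in states_at a].

Definition is_aadjoint (a x y : A) : Prop := a * y = star x * a.

Definition aadjointable (a : A) : set A :=
  [set x | exists y, is_aadjoint a x y].

End CStarAlgebraDefs.

(* Main.v *)
Require Import Defs.
From HB Require Import structures.
From mathcomp Require Import all_boot all_order all_algebra.
From mathcomp Require Import all_classical all_reals all_analysis.
From mathcomp Require Import complex ring lra.

Set Implicit Arguments.
Unset Strict Implicit.
Unset Printing Implicit Defensive.

Import Order.TTheory GRing.Theory Num.Theory.

Local Open Scope classical_set_scope.
Local Open Scope ring_scope.

(* For a positive functional [g] with [g a = 1] and [a = star b * b], the form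
   <u, v> = g (star u * v) is positive semidefinite and [b] is a unit vector for
   it.  Buzano's inequality
     2 |<u, b> <b, v>| <= |<u, v>| + (<u, u> + <v, v>) / 2
   for u = b * xs and v = b * x reads
     2 |g (a x)|^2 <= |g (a x^2)| + g (a (x xs + xs x)) / 2,
   and the last term is at most [anorm a (x xs + xs x) / 2] by
   Cauchy-Schwarz. *)

Lemma star_conjZ (R : realType) (A : cstarAlgType R) (c : R[i]) (u : A) :
  star (c *: u) = c^* *: star u.
Proof. exact: starZ. Qed.

Section PositiveFunctional.
Variables (R : realType) (A : cstarAlgType R) (g : {scalar A}).
Hypothesis g_ge0 : forall p : A, positive p -> 0 <= g p.

Implicit Types (u v e : A) (c : R[i]).

Lemma pfun_sqr_ge0 u : 0 <= g (star u * u).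
Proof. by apply: g_ge0; exists u. Qed.

Lemma pfun_sqrD c u v :
  g (star (u + c *: v) * (u + c *: v)) =
  g (star u * u) + c * g (star u * v) + c^* * g (star v * u)
  + c^* * c * g (star v * v).
Proof.
have -> : star (u + c *: v) * (u + c *: v) = star u * u + c *: (star u * v)
    + c^* *: (star v * u) + c^* *: (c *: (star v * v)).
  by rewrite starD star_conjZ mulrDl !mulrDr -!scalerAl -!scalerAr !addrA.
by rewrite !linearD !linearZ /= !mulrA.
Qed.

(** Polarization: [g] is real on the squares of [u + v] and [u + 'i *: v], which makes [s + t] real
    and [s - t] purely imaginary, so [t] is the conjugate of [s]. *)
Lemma pfun_star u v : g (star v * u) = (g (star u * v))^*.
Proof.
have real_sqr w : (g (star w * w))^* = g (star w * w).
  by apply/CrealP; rewrite ger0_real ?pfun_sqr_ge0.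
have := real_sqr (u + 1 *: v); have := real_sqr (u + 'i *: v).
rewrite !pfun_sqrD !rmorphD !rmorphM /= !conjCK !real_sqr conjC1 conjCi.
set s := g (star u * v); set t := g (star v * u) => Ei E1.
have {}E1 : s^* + t^* = s + t.
  apply/eqP; rewrite -subr_eq0; apply/eqP.
  by move/eqP: E1; rewrite -subr_eq0 => /eqP <-; ring.
have {}Ei : t^* - s^* = s - t.
  apply: (mulfI (neq0Ci _)); apply/eqP; rewrite -subr_eq0; apply/eqP.
  by move/eqP: Ei; rewrite -subr_eq0 => /eqP <-; ring.
have : 2 * t = 2 * s^*.
  have -> : 2 * t = (s + t) - (s - t) by ring.
  by rewrite -E1 -Ei; ring.
by apply: mulfI; rewrite pnatr_eq0.
Qed.

Lemma pfun_AMGM u v :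
  2 * `|g (star u * v)| <= g (star u * u) + g (star v * v).
Proof.
set s := g (star u * v).
have [->|s0] := eqVneq s 0.
  by rewrite normr0 mulr0 addr_ge0 ?pfun_sqr_ge0.
have n0 : `|s| != 0 by rewrite normr_eq0.
(* The coefficient of [v] has modulus 1 and a phase that turns both cross terms into [- |s|]. *)
have := pfun_sqr_ge0 (u + (- (s^* / `|s|)) *: v).
rewrite pfun_sqrD (pfun_star u v) -/s rmorphN rmorphM /= conjCK fmorphV /=.
rewrite conj_normC.
have -> : - (s^* / `|s|) * s = - `|s|.
  by rewrite mulNr mulrAC [s^* * s]mulrC -normCK expr2 mulfK.
have -> : - (s / `|s|) * s^* = - `|s|.
  by rewrite mulNr mulrAC -normCK expr2 mulfK.
have -> : - (s / `|s|) * - (s^* / `|s|) = 1.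
  by rewrite mulrNN mulrACA -normCK expr2 -invfM divff // mulf_neq0.
rewrite mul1r => ge0; rewrite -subr_ge0; apply: etrans ge0.
by congr (0 <= _); ring.
Qed.

Lemma pfun_CauchySchwarz_unit e v : g (star e * e) = 1 ->
  `|g (star e * v)| ^+ 2 <= g (star v * v).
Proof.
move=> e1; set s := g (star e * v).
(* This is the component of [v] orthogonal to [e]; its square length is <v, v> - |s|^2. *)
have := pfun_sqr_ge0 (v + (- s) *: e).
rewrite pfun_sqrD (pfun_star e v) e1 -/s rmorphN /= => ge0.
by rewrite -subr_ge0 normCK; apply: etrans ge0; congr (0 <= _); ring.
Qed.

(* Apply [pfun_AMGM] to [v] and the reflection [2 <e, u> e - u] of [u], which has
   the same length as [u]. *)
Lemma pfun_Buzano e u v : g (star e * e) = 1 ->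
  2 * `|g (star u * e) * g (star e * v)| <=
  `|g (star u * v)| + 2^-1 * (g (star u * u) + g (star v * v)).
Proof.
move=> e1; set s := g (star u * e); set t := g (star e * v).
set w := - u + (2 * s^*) *: e.
have gu z : g (star (- u) * z) = - g (star u * z).
  by rewrite -scaleN1r star_conjZ conjCN1 scaleN1r mulNr linearN.
have gw : g (star w * v) = 2 * (s * t) - g (star u * v).
  rewrite starD star_conjZ mulrDl linearD /= gu -scalerAl linearZ /= -/t.
  rewrite rmorphM /= conjCK conjC_nat; ring.
have ww : g (star w * w) = g (star u * u).
  rewrite pfun_sqrD !gu (pfun_star (- u) e) gu -/s e1 mulrN linearN /=.
  rewrite rmorphM rmorphN /= conjCK conjC_nat; ring.
(* Since <w, v> = 2 s t - <u, v>, the reverse triangle inequality finishes the proof. *)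
have := pfun_AMGM w v; rewrite ww gw => le_wv.
have -> : 2 * `|s * t| = `|2 * (s * t)|
  by rewrite [RHS]normrM gtr0_norm ?ltr0n.
rewrite -lerBlDl; apply: le_trans (lerB_dist _ _) _.
by rewrite ler_pdivlMl ?ltr0n.
Qed.

Lemma pfun_aadjoint_Buzano (a x xs : A) : positive a -> g a = 1 ->
    is_aadjoint a x xs ->
  2 * `|g (a * x)| ^+ 2 <=
  `|g (a * x ^+ 2)| + 2^-1 * g (a * (x * xs + xs * x)).
Proof.
move=> [b ->] e1; rewrite /is_aadjoint !mulrA => hxs.
(* Taking stars in the adjoint relation lets [xs] on the left of [a] become [x] on its right, so all
   three inner products take the form [g (a * _)]. *)
have hxs' : star xs * star b * b = star b * b * x.
  by have := congr1 star hxs; rewrite !starM !starK !mulrA.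
have := @pfun_Buzano b (b * xs) (b * x) e1.
by rewrite !starM !mulrA hxs' -hxs -linearD -!mulrA -!mulrDr normrM -!expr2.
Qed.

End PositiveFunctional.

Lemma nneg_sup_ubound (R : realType) (E : set (\bar R)) : ubound E (nneg_sup E).
Proof. by move=> y Ey; apply: ereal_sup_ubound; right. Qed.

Lemma nneg_sup_ge0 (R : realType) (E : set (\bar R)) : (0 <= nneg_sup E)%E.
Proof. by apply: ereal_sup_ubound; left. Qed.

Lemma nneg_sup_sqr_le (R : realType) (E : set (\bar R)) (r : R) : 0 <= r ->
  (forall y, E y -> exists2 z : R, y = z%:E & z ^+ 2 <= r) ->
  (nneg_sup E ^+ 2 <= r%:E)%E.
Proof.
move=> r0 Er.
(* This bound makes the supremum finite, so that squares can be compared in [R]. *)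
have le_sqrt : (nneg_sup E <= (Num.sqrt r)%:E)%E.
  apply: ge_ereal_sup => y [->|/Er[z -> zr]]; rewrite lee_fin ?sqrtr_ge0 //.
  by rewrite (le_trans (ler_norm _)) // -sqrtr_sqr ler_wsqrtr.
have := nneg_sup_ge0 E; case: (nneg_sup E) le_sqrt => [s| |] //=.
rewrite !lee_fin => sr s0; rewrite -expr2.
by rewrite -(sqr_sqrtr r0) lerXn2r // nnegrE sqrtr_ge0.
Qed.

Section StatesAt.
Variables (R : realType) (A : cstarAlgType R) (a : A).
Hypothesis ha : positive a.

(** Recovers linearity, since members of [states_at a] are bare functions. Dividing by [f a] keeps
    positivity because [f a >= 0] for positive [a]. *)
Lemma states_at_pfun (g : A -> R[i]) : states_at a g ->
  exists2 h : {scalar A}, g = h & (forall p, positive p -> 0 <= h p) /\ h a = 1.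
Proof.
move=> [f [[f_ge0 _] fa0 ->]].
exists ((f a)^-1 \*: (f : A -> R[i]^o)).
  by apply/funext => x /=; rewrite mulrC.
split=> [p /f_ge0 fp|] /=; last by rewrite [LHS]mulVf.
by rewrite mulr_ge0 // invr_ge0 f_ge0.
Qed.

(** With [a = star b * b], g (a T) is the inner product of the unit vector [b] with [b * T], whose
    length is one of the numbers in the supremum [anorm a T]. *)
Lemma states_at_anorm (g : A -> R[i]) (T : A) : states_at a g ->
  ((complex.Re (g (a * T)))%:E <= anorm a T)%E.
Proof.
move=> gS; apply: le_trans (nneg_sup_ubound _); last by exists g.
rewrite lee_fin; have [h -> [h_ge0 h1]] := states_at_pfun gS.
have [b ab] := ha; rewrite ab in h1 *.
have := pfun_CauchySchwarz_unit h_ge0 (b * T) h1.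
rewrite starM !mulrA.
set s := h _; set t := h _ => st.
apply: le_trans (ler_norm _) _; rewrite -sqrtr_sqr ler_wsqrtr //.
have : (`|complex.Re s| ^+ 2)%:C%C <= t.
  apply: le_trans st; rewrite rmorphXn /= lerXn2r ?nnegrE ?normc_ge_Re //.
  by rewrite lecR.
by rewrite lecE real_normK ?num_real // => /andP[].
Qed.

End StatesAt.

Theorem theorem3p3 (R : realType) (A : cstarAlgType R) (a : A)
    (ha : positive a) (ha0 : a != 0) (x : A) (hx : aadjointable a x)
    (xs : A) (hxs : is_aadjoint a x xs) :
  (anumradius a x ^+ 2 <=
     (2^-1)%:E * anumradius a (x ^+ 2)%R +
     (4^-1)%:E * anorm a (x * xs + xs * x)%R)%E.
Proof.
set T := x * xs + xs * x.
have anr_ge0 : (0 <= anumradius a (x ^+ 2)%R)%E by exact: nneg_sup_ge0.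
have ann_ge0 : (0 <= anorm a T)%E by exact: nneg_sup_ge0.
(* Only a finite right-hand side needs work: nonnegativity excludes [-oo], and [+oo] is trivial. *)
case E : (_ + _)%E => [r| |]; first last.
- have : (0 <= -oo :> \bar R)%E by rewrite -E adde_ge0 ?mule_ge0 ?lee_fin.
  by [].
- exact: leey.
apply: nneg_sup_sqr_le.
  by rewrite -lee_fin -E adde_ge0 // mule_ge0 // lee_fin.
move=> _ [g gS <-]; exists (ComplexField.Normc.normc (g (a * x))) => //.
rewrite -lee_fin -E.
have [h gh [h_ge0 h1]] := states_at_pfun ha gS.
have := pfun_aadjoint_Buzano h_ge0 ha h1 hxs; rewrite -gh -/T.
have := states_at_anorm ha T gS.
have : ((ComplexField.Normc.normc (g (a * x ^+ 2)))%:E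
  <= anumradius a (x ^+ 2)%R)%E by apply: nneg_sup_ubound; exists g.
set s := g (a * x); set t := g (a * x ^+ 2); set w := g (a * T).
move=> tle wle stw.
(* Order in [R[i]] compares real parts between numbers of equal imaginary part; the real part of
   Buzano's bound, halved, gives the constants 1/2 and 1/4. *)
have {}stw : ComplexField.Normc.normc s ^+ 2 <=
    2^-1 * ComplexField.Normc.normc t + 4^-1 * complex.Re w.
  move: stw; change (`|s|) with (ComplexField.Normc.normc s)%:C%C.
  change (`|t|) with (ComplexField.Normc.normc t)%:C%C.
  rewrite -(rmorph_nat (real_complex R)) -fmorphV -rmorphXn -rmorphM.
  by rewrite lecE => /andP[_]; case: w {wle} => w1 w2 /=; lra.
apply: le_trans (_ : (2^-1 * ComplexField.Normc.normc t
  + 4^-1 * complex.Re w)%:E <= _)%E; first by rewrite lee_fin.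
by rewrite EFinD !EFinM leeD // lee_pmul2l // lte_fin invr_gt0 ltr0n.
Qed.
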